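(* For all $0\le\alpha<1$ and all positive integers $n$, $$\Pr_{X\sim\mathcal{G}^{n\times n}}\left[|\mathrm{Per}(X)|^2\ge\alpha\cdot n!\right]>\frac{(1-\alpha)^2}{n+1}.$$
   Context: $\mathcal{G}=\mathcal{N}(0,1)_{\mathbb{C}}$ is the complex Gaussian distribution with mean $0$ and $\mathrm{E}|z|^2=1$; $\mathcal{G}^{n\times n}$ is the distribution over $n\times n$ complex matrices with i.i.d. entries from $\mathcal{G}$. $\mathrm{Per}(X)=\sum_{\sigma\in S_n}\prod_{i=1}^n x_{i,\sigma(i)}$ is the permanent. *)

(* Defs.v *)
From HB Require Import structures.
From mathcomp Require Import all_boot all_order all_algebra all_fingroup.
From mathcomp Require Import all_classical all_reals all_analysis.
From mathcomp Require Import complex.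

Set Implicit Arguments.
Unset Strict Implicit.
Unset Printing Implicit Defensive.

Import Order.TTheory GRing.Theory Num.Theory.

Local Open Scope classical_set_scope.
Local Open Scope ring_scope.
Local Open Scope complex_scope.

Definition permanent (S : comNzRingType) (n : nat) (X : 'M[S]_n) : S :=
  \sum_(s : 'S_n) \prod_(i < n) X i (s i).

Section measurable_complex.
Context {R : realType}.

HB.instance Definition _ := isPointed.Build R[i] (0 : R[i]).

(* This is the Borel sigma-algebra of the plane. *)
Definition complex_generator : set (set R[i]) :=
  preimage_set_system setT (fun z : R[i] => (complex.Re z, complex.Im z))
    (measurable : set (set (measurableTypeR R * measurableTypeR R))).

HB.instance Definition _ := @isMeasurable.Build (sigma_display complex_generator)
  R[i] <<s complex_generator >> (@sigma_algebra0 _ setT complex_generator)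
  (@sigma_algebraC _ complex_generator)
  (@sigma_algebra_bigcup _ setT complex_generator).

Definition complex_of_pair (p : measurableTypeR R * measurableTypeR R) : R[i] :=
  p.1 +i* p.2.

Lemma measurable_complex_of_pair : measurable_fun setT complex_of_pair.
Proof.
apply: (@measurability _ _ _ _ setT complex_of_pair complex_generator) => //.
move=> _ [_ [B mB <-] <-].
rewrite !setTI; rewrite [X in measurable X](_ : _ = B)//.
by apply/seteqP; split => -[].
Qed.

HB.instance Definition _ :=
  isMeasurableFun.Build _ _ _ _ complex_of_pair measurable_complex_of_pair.

End measurable_complex.

Section measurable_matrix.
Context {d} {T : measurableType d} {m n : nat}.

(* The product sigma-algebra, generated by the coordinate maps. *)
Definition matrix_generator : set (set 'M[T]_(m, n)) :=
  \bigcup_(ij in [set: 'I_m * 'I_n])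
    preimage_set_system setT (fun X : 'M[T]_(m, n) => X ij.1 ij.2) measurable.

HB.instance Definition _ := @isMeasurable.Build (sigma_display matrix_generator)
  'M[T]_(m, n) <<s matrix_generator >>
  (@sigma_algebra0 _ setT matrix_generator)
  (@sigma_algebraC _ matrix_generator)
  (@sigma_algebra_bigcup _ setT matrix_generator).

Definition matrix_of_tuple (t : m.-tuple (n.-tuple T)) : 'M[T]_(m, n) :=
  \matrix_(i < m, j < n) tnth (tnth t i) j.

Lemma measurable_matrix_of_tuple : measurable_fun setT matrix_of_tuple.
Proof.
apply: (@measurability _ _ _ _ setT matrix_of_tuple matrix_generator) => //.
move=> _ [_ [[i j] _ [B mB <-]] <-].
rewrite !setTI /=.
rewrite [X in measurable X](_ : _ =
  ((fun t : m.-tuple (n.-tuple T) => tnth (tnth t i) j) @^-1` B)); last first.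
  by apply/seteqP; split => t /=; rewrite /matrix_of_tuple mxE.
rewrite -[X in measurable X]setTI.
apply: (measurableT_comp (measurable_tnth j) (measurable_tnth i)) => //.
Qed.

HB.instance Definition _ :=
  isMeasurableFun.Build _ _ _ _ matrix_of_tuple measurable_matrix_of_tuple.

End measurable_matrix.

Section iid.
Context {d} {T : measurableType d} {R : realType}.
Local Open Scope ereal_scope.

Definition cons_pair (n : nat) (p : T * n.-tuple T) : n.+1.-tuple T :=
  [tuple of p.1 :: p.2].

Lemma measurable_cons_pair (n : nat) : measurable_fun setT (@cons_pair n).
Proof. exact: measurable_cons. Qed.

HB.instance Definition _ (n : nat) :=
  isMeasurableFun.Build _ _ _ _ (@cons_pair n) (@measurable_cons_pair n).

(* The [n]-fold product measure, i.e. the law of [n] i.i.d. samples of [P]. *)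
Fixpoint iid_tuple (P : probability T R) (n : nat) :
    probability (n.-tuple T) R :=
  if n is n'.+1 then distribution (P \x iid_tuple P n') (@cons_pair n')
  else dirac [tuple].

Lemma iid_tupleE (P : probability T R) (n : nat) (A : 'I_n -> set T) :
  (forall i, measurable (A i)) ->
  iid_tuple P n [set t | forall i, A i (tnth t i)] = \prod_(i < n) P (A i).
Proof.
elim: n A => [|n IHn] A mA.
  rewrite big_ord0 /= diracE mem_set//; by case.
rewrite big_ord_recl -IHn//= /distribution /pushforward.
rewrite [X in (_ \x _) X](_ : _ = A ord0 `*`
  [set t : n.-tuple T | forall i, A (lift ord0 i) (tnth t i)]).
  rewrite product_measure1E//.
  rewrite [X in measurable X](_ : _ = \bigcap_(i in [set: 'I_n])
     ((fun t : n.-tuple T => tnth t i) @^-1` A (lift ord0 i))).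
    apply: fin_bigcap_measurable => // i _.
    by rewrite -[X in measurable X]setTI; exact: measurable_tnth.
  by apply/seteqP; split => [t tA i _|t tA i]; [exact: tA|exact: (tA i)].
apply/seteqP; split => [[x t] /= xtA|[x t] /= [xA tA] i].
  split; first exact: (xtA ord0).
  by move=> i; have := xtA (lift ord0 i); rewrite tnthS.
by case: (unliftP ord0 i) => [j ->|->] //; rewrite tnthS; exact: tA.
Qed.

End iid.

Definition iid_matrix d (T : measurableType d) (R : realType)
    (P : probability T R) (m n : nat) : probability 'M[T]_(m, n) R :=
  distribution (iid_tuple (iid_tuple P n) m) matrix_of_tuple.

(* The entries are i.i.d. with law [P]; since measurable rectangles form a
   pi-system generating the sigma-algebra, this determines the measure. *)
Lemma iid_matrixE d (T : measurableType d) (R : realType) (P : probability T R)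
    (m n : nat) (A : 'I_m -> 'I_n -> set T) :
  (forall i j, measurable (A i j)) ->
  iid_matrix P m n [set X | forall i j, A i j (X i j)] =
    (\prod_(i < m) \prod_(j < n) P (A i j))%E.
Proof.
move=> mA; rewrite /iid_matrix /= /distribution /pushforward.
under eq_bigr => i _ do rewrite -iid_tupleE//.
rewrite -iid_tupleE.
  congr (iid_tuple _ _ _); apply/seteqP; split => t /= tA i j;
    by have := tA i j; rewrite mxE.
move=> i.
rewrite [X in measurable X](_ : _ = \bigcap_(j in [set: 'I_n])
   ((fun t : n.-tuple T => tnth t j) @^-1` A i j)).
  apply: fin_bigcap_measurable => // j _.
  by rewrite -[X in measurable X]setTI; exact: measurable_tnth.
by apply/seteqP; split => [t tA j _|t tA j]; [exact: tA|exact: (tA j)].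
Qed.

Section complex_gaussian.
Variable R : realType.

(* The standard deviation of the real and imaginary parts is [Num.sqrt 2^-1],
   which makes the expectation of [|z|^2] equal to [2^-1 + 2^-1 = 1]. *)
Definition complex_gaussian : probability R[i] R :=
  distribution (normal_prob 0 (Num.sqrt 2^-1) \x normal_prob 0 (Num.sqrt 2^-1))%E
    complex_of_pair.

Definition gaussian_matrix (n : nat) : probability 'M[R[i]]_n R :=
  iid_matrix complex_gaussian n n.

End complex_gaussian.

(* Main.v *)
(* Let Z = |Per X|^2.  Expanding into permutations, E Z = n!, and Wick's formula
   E[x_a x_b conj(x_c) conj(x_e)] = [a=c][b=e] + [a=e][b=c] applied to each row,
   then distributed over the set W of rows where the first term is chosen, gives
   E Z^2 = sum_W #{(s,t) : s(W) = t(W)} = n! * sum_s #{W : s(W) = W}, which is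
   n!^2 times the number of orbits of S_n on subsets, i.e. (n+1) n!^2.  The bound
   is then the Paley-Zygmund inequality.  It is strict for alpha > 0 because the
   part of E Z where Z < alpha n! is at most alpha n! P(Z < alpha n!), with
   P(Z < alpha n!) < 1; for alpha = 0 the probability is 1.
   The moments of the normal law come from integrating (x^k phi)' = 0. *)

Require Import Defs.
From HB Require Import structures.
From mathcomp Require Import all_boot all_order all_algebra all_fingroup.
From mathcomp Require Import all_classical all_reals all_analysis.
From mathcomp Require Import measurable_realfun complex.
From mathcomp Require Import ring lra.

Set Implicit Arguments.
Unset Strict Implicit.
Unset Printing Implicit Defensive.

Import Order.TTheory GRing.Theory Num.Theory.
Import numFieldNormedType.Exports.

Local Open Scope classical_set_scope.
Local Open Scope ring_scope.
Local Open Scope complex_scope.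

(** * Moments of the normal distribution *)

Section normal_moments.
Context {R : realType}.
Local Notation mu := (@lebesgue_measure R).

(** The normal law is dominated by Lebesgue measure, so change of variables holds with its
    Radon-Nikodym derivative. That derivative and [normal_pdf] have the same integral over every
    measurable set, hence agree almost everywhere. *)
Lemma ge0_integral_normal_prob (m s : R) (f : R -> \bar R) :
  measurable_fun setT f -> (forall x, 0 <= f x)%E ->
  (\int[normal_prob m s]_x f x = \int[mu]_x (f x * (normal_pdf m s x)%:E))%E.
Proof.
move=> mf f0.
have dom := @normal_prob_dominates R m s.
rewrite -(Radon_Nikodym_SigmaFinite.change_of_variables dom)//.
apply: ae_eq_integral => //.
- apply: emeasurable_funM => //.
  exact: (measurable_int mu (Radon_Nikodym_SigmaFinite.f_integrable dom)).
- apply: emeasurable_funM => //.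
  by apply/measurable_EFinP; exact: measurable_normal_pdf.
- apply: ae_eqe_mul2l => /=; apply: integral_ae_eq => //=.
  + exact: Radon_Nikodym_SigmaFinite.f_integrable.
  + by apply/measurable_EFinP; exact: measurable_normal_pdf.
  + by move=> E _ mE; rewrite -Radon_Nikodym_SigmaFinite.f_integral.
Qed.

Lemma integrable_normal_prob (m s : R) (f : R -> R) :
  mu.-integrable setT (EFin \o (fun x => f x * normal_pdf m s x)) ->
  measurable_fun setT f ->
  (normal_prob m s).-integrable setT (EFin \o f).
Proof.
move=> /integrableP[_ h] mf; apply/integrableP; split.
  exact/measurable_EFinP.
rewrite ge0_integral_normal_prob//.
  apply: le_lt_trans h; rewrite le_eqVlt; apply/orP; left; apply/eqP.
  apply: eq_integral => x _ /=.
  by rewrite normrM (ger0_norm (normal_pdf_ge0 _ _ _)).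
by apply: measurableT_comp => //; exact/measurable_EFinP.
Qed.

Lemma integral_normal_prob (m s : R) (f : R -> R) :
  mu.-integrable setT (EFin \o (fun x => f x * normal_pdf m s x)) ->
  measurable_fun setT f ->
  (\int[normal_prob m s]_x (f x)%:E =
   \int[mu]_x (f x * normal_pdf m s x)%:E)%E.
Proof.
move=> intf mf.
rewrite [LHS]integralE [RHS]integralE; congr (_ - _)%E.
  rewrite ge0_integral_normal_prob//.
    apply: eq_integral => x _; rewrite !funeposE/= -!EFin_max -EFinM.
    by rewrite maxr_pMl ?normal_pdf_ge0// mul0r.
  exact/measurable_funepos/measurable_EFinP.
rewrite ge0_integral_normal_prob//.
  apply: eq_integral => x _; rewrite !funenegE/= -!EFin_max -EFinM.
  by rewrite maxr_pMl ?normal_pdf_ge0// mul0r mulNr.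
exact/measurable_funeneg/measurable_EFinP.
Qed.

(** The fundamental theorem of calculus on growing symmetric intervals, where the boundary terms
    vanish in the limit; dominated convergence with bound [|f|] passes to the whole line. *)
Lemma integral_derive_eq0 (F f : R -> R) :
  (forall x : R, is_derive x (1 : R) F (f x)) -> continuous f ->
  mu.-integrable setT (EFin \o f) ->
  F n%:R @[n --> \oo] --> 0 -> F (- n%:R) @[n --> \oo] --> 0 ->
  (\int[mu]_x (f x)%:E = 0)%E.
Proof.
move=> dF cf intf Fy FNy.
have mf : measurable_fun setT f by exact: continuous_measurable_fun.
have cF : continuous F.
  by move=> x; apply: differentiable_continuous; apply/derivable1_diffP.
(* Using [n.+1] keeps the interval nondegenerate at [n = 0], as [continuous_FTC2] requires. *)
pose f_ (n : nat) := ((EFin \o f) \_ `[- n.+1%:R, n.+1%:R]).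
have [] := @dominated_convergence _ _ R mu setT measurableT f_ (EFin \o f)
  (abse \o (EFin \o f)).
- move=> n; apply/(measurable_restrictT _ _).1 => //.
  by apply: measurable_funTS; exact/measurable_EFinP.
- exact/measurable_EFinP.
- apply: aeW => x _; apply: cvg_near_cst.
  near=> n; rewrite /f_ patchE mem_set//=.
  rewrite in_itv/= -ler_norml.
  have : `|x| <= n%:R by near: n; exact: nbhs_infty_ger.
  by move=> /le_trans; apply; rewrite ler_nat.
- exact: integrable_abse.
- apply: aeW => x n _; rewrite /f_ patchE; case: ifP => _ //.
  by rewrite abse0 abse_ge0.
move=> _ _ cvg1.
suff cvg2 : (fun n => \int[mu]_x f_ n x)%E @ \oo --> 0%E.
  exact: (cvg_unique _ cvg1 cvg2).
rewrite (_ : (fun n => _) = (fun n => (F n.+1%:R - F (- n.+1%:R))%:E)).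
  apply: cvg_EFin; first exact: nearW.
  rewrite -[X in _ --> X](subr0 0); apply: cvgB.
    by have := Fy; rewrite -(cvg_shiftS (fun n => F n%:R)).
  by have := FNy; rewrite -(cvg_shiftS (fun n => F (- n%:R))).
apply/funext => n; rewrite /f_ -integral_mkcond/=.
rewrite (@continuous_FTC2 _ f F).
- by rewrite EFinB.
- by rewrite -subr_gt0 opprK -natrD ltr0n addnS.
- exact: continuous_subspaceT.
- split => [x _||]; first by have [] := dF x.
    exact/cvg_at_right_filter/cF.
  exact/cvg_at_left_filter/cF.
- by move=> x _; rewrite derive1E; have [_ ->] := dF x.
Unshelve. all: by end_near. Qed.

End normal_moments.

(** * Moments up to order four of the centred normal law of variance 1/2 *)

Section standard_moments.
Context {R : realType}.
Local Notation mu := (@lebesgue_measure R).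
Local Notation phi := (normal_pdf 0 (Num.sqrt (2^-1 : R))).

Lemma sqrt_half_neq0 : Num.sqrt (2^-1 : R) != 0.
Proof. by rewrite gt_eqF// sqrtr_gt0 invr_gt0. Qed.

Lemma normal_pdf_half (x : R) :
  phi x = normal_peak (Num.sqrt (2^-1 : R)) * gauss_fun x.
Proof.
rewrite normal_pdfE ?sqrt_half_neq0// /normal_fun /gauss_fun subr0.
rewrite sqr_sqrtr ?invr_ge0//.
by have -> : (2^-1 : R) *+ 2 = 1; [rewrite -mulr_natr; field|rewrite divr1].
Qed.

(** Split [exp(-x^2)] into two equal factors [exp(-x^2/2)]: one absorbs the power of [x], the other
    remains as an integrable bound. *)
Lemma expr_gauss_fun_le (k : nat) (x : R) : (k <= 4)%N ->
  `|x ^+ k * gauss_fun x| <= 9 * expR (- x ^+ 2 / 2).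
Proof.
move=> k4; rewrite normrM (ger0_norm (gauss_fun_ge0 _)) normrX.
have -> : gauss_fun x = expR (- x ^+ 2 / 2) * expR (- x ^+ 2 / 2).
  by rewrite /gauss_fun -expRD; congr expR; field.
rewrite mulrA ler_wpM2r ?expR_ge0//.
rewrite mulNr expRN ler_pdivrMr ?expR_gt0//.
apply: (@le_trans _ _ (1 + x ^+ 4)).
  have -> : x ^+ 4 = `|x| ^+ 4 by rewrite -normrX ger0_norm// exprn_even_ge0.
  have [x1|x1] := leP `|x| 1.
    by rewrite ler_wpDr ?exprn_ge0// exprn_ile1.
  by rewrite ler_wpDl// ler_weXn2l// ltW.
have x2 : 0 <= x ^+ 2 / 2 by rewrite divr_ge0// sqr_ge0.
(* With [y = x^2/2], [exp y >= 1 + y^2/2! = 1 + x^4/8], and 9 times this exceeds [1 + x^4]. *)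
have := @expR_ge1Dxn R (x ^+ 2 / 2) 1 x2.
have -> : 2`!%:R = 2 :> R by [].
by nra.
Qed.

(** Follows from [(|x| - 1)^2 >= 0]. It reduces decay at infinity to that of [exp(-|x|)]. *)
Lemma expR_half_sqr_le (x : R) : expR (- x ^+ 2 / 2) <= expR 1 * expR (- `|x|).
Proof.
rewrite -expRD ler_expR -(real_normK (num_real x)).
by have := sqr_ge0 (`|x| - 1); lra.
Qed.

Lemma integrable_expr_normal (k : nat) : (k <= 4)%N ->
  mu.-integrable setT (EFin \o (fun x => x ^+ k * phi x)).
Proof.
move=> k4.
set c := normal_peak (Num.sqrt (2^-1 : R)).
have c0 : 0 <= c by exact: normal_peak_ge0.
(* The dominating function [9 c exp(-x^2/2)] is written as a multiple of the standard normal
   density, whose integrability is known. *)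
apply: (@le_integrable _ _ _ mu _ measurableT _
  (fun x => (c * 9 / normal_peak 1)%:E * (normal_pdf 0 1 x)%:E)%E).
- apply/measurable_EFinP; apply: measurable_funM => //.
  exact: measurable_normal_pdf.
- move=> x _ /=; rewrite lee_fin normal_pdf_half -/c.
  rewrite normal_pdfE ?oner_neq0// /normal_fun subr0 expr1n.
  have -> : c * 9 / normal_peak 1 * (normal_peak 1 * expR (- x ^+ 2 / 2)) =
      c * (9 * expR (- x ^+ 2 / 2)).
    by field; rewrite gt_eqF// normal_peak_gt0// oner_neq0.
  rewrite mulrCA normrM [X in X * _]ger0_norm// [leRHS]ger0_norm.
    by rewrite ler_wpM2l//; exact: expr_gauss_fun_le.
  by rewrite !mulr_ge0// expR_ge0.
- by apply: integrableZl => //; exact: integrable_normal_pdf.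
Qed.

Lemma cvg_expr_normal (k : nat) (u : R^nat) : (k <= 4)%N ->
  `|u n| @[n --> \oo] --> +oo -> u n ^+ k * phi (u n) @[n --> \oo] --> 0.
Proof.
move=> k4 uy; apply: norm_cvg0.
set c := normal_peak (Num.sqrt (2^-1 : R)).
have c0 : 0 <= c by exact: normal_peak_ge0.
apply: (@squeeze_cvgr _ _ _ _ (cst 0) (fun n => c * 9 * expR 1 * expR (- `|u n|))).
- near=> n; rewrite normr_ge0/= normal_pdf_half -/c mulrCA normrM.
  rewrite [X in X * _]ger0_norm// -!mulrA ler_wpM2l//.
  apply: (le_trans (expr_gauss_fun_le _ k4)).
  by rewrite ler_wpM2l//; exact: expR_half_sqr_le.
- exact: cvg_cst.
- rewrite -[X in _ --> X](mulr0 (c * 9 * expR 1)).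
  apply: cvgM; first exact: cvg_cst.
  exact: (cvg_comp _ _ uy (@cvgr_expR R)).
Unshelve. all: by end_near. Qed.

Lemma is_derive_normal_pdf (x : R) : is_derive x (1 : R) phi (- (2 * x * phi x)).
Proof.
set c := normal_peak (Num.sqrt (2^-1 : R)).
have -> : phi = (fun x => c * expR (- x ^+ 2)).
  by apply/funext => y; rewrite normal_pdf_half.
apply: is_derive_eq.
rewrite !scaler1 /GRing.scale/=; ring.
Qed.

(** The integrand is the derivative of [x^k phi], since [phi' = -2 x phi]. At [k = 0] the truncated
    exponent [k.-1] is harmless because its coefficient is 0. *)
Lemma integral_stein (k : nat) : (k <= 3)%N ->
  (\int[mu]_x (k%:R * (x ^+ k.-1 * phi x) - 2 * (x ^+ k.+1 * phi x))%:E = 0)%E.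
Proof.
move=> k3; apply: (@integral_derive_eq0 _ (fun x => x ^+ k * phi x)).
- move=> x; have dphi := is_derive_normal_pdf x.
  have -> : (fun y : R => y ^+ k * phi y) = (@id R) ^+ k * phi.
    by apply/funext => y; rewrite !fctE.
  have dX := is_deriveX k (is_derive_id x (1 : R)).
  have /is_derive_eq := is_deriveM dX dphi; apply.
  by rewrite /GRing.scale/= !fctE exprS; ring.
- move=> x; have cphi := @continuous_normal_pdf R 0 _ sqrt_half_neq0 x.
  apply: cvgB; (apply: cvgM; first exact: cvg_cst); apply: cvgM => //;
    exact: exprn_continuous.
- have i1 : mu.-integrable setT (fun x => k%:R%:E * (x ^+ k.-1 * phi x)%:E)%E.
    apply: integrableZl => //; apply: integrable_expr_normal.
    by rewrite (leq_trans (leq_pred _))// (leq_trans k3).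
  have i2 : mu.-integrable setT (fun x => 2%:E * (x ^+ k.+1 * phi x)%:E)%E.
    by apply: integrableZl => //; exact: integrable_expr_normal.
  exact: (integrableB measurableT i1 i2).
- apply: cvg_expr_normal; first exact: ltnW.
  rewrite (_ : (fun n => _) = (fun n => n%:R)); first exact: cvgr_idn.
  by apply/funext => n; rewrite ger0_norm.
- apply: cvg_expr_normal; first exact: ltnW.
  rewrite (_ : (fun n => _) = (fun n => n%:R)); first exact: cvgr_idn.
  by apply/funext => n; rewrite normrN ger0_norm.
Qed.

Lemma integral_expr_normal_rec (k : nat) : (k <= 3)%N ->
  (\int[mu]_x (x ^+ k.+1 * phi x)%:E =
   (k%:R / 2)%:E * \int[mu]_x (x ^+ k.-1 * phi x)%:E)%E.
Proof.
move=> k3.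
have i0 : mu.-integrable setT (EFin \o (fun x => x ^+ k.-1 * phi x)).
  apply: integrable_expr_normal.
  by rewrite (leq_trans (leq_pred _))// (leq_trans k3).
have i3 : mu.-integrable setT (EFin \o (fun x => x ^+ k.+1 * phi x)).
  exact: integrable_expr_normal.
have := integral_stein k3.
under eq_integral do rewrite EFinB 2!EFinM.
rewrite (integralB measurableT (integrableZl measurableT k%:R i0)
  (integrableZl measurableT 2 i3)) !integralZl//.
have /fineK <- := integrable_fin_num measurableT i0.
have /fineK <- := integrable_fin_num measurableT i3.
rewrite -!EFinM -EFinB => -[] h; congr EFin.
by lra.
Qed.

(** These are the moments for variance 1/2 only up to order 4; beyond that, 0 is a default value. *)
Definition normal_moment (k : nat) : R :=
  if k == 0%N then 1 else if k == 2 then 2^-1 else if k == 4 then 3 / 4 else 0.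

Lemma integral_expr_normal (k : nat) : (k <= 4)%N ->
  (\int[mu]_x (x ^+ k * phi x)%:E = (normal_moment k)%:E)%E.
Proof.
have m0 : (\int[mu]_x (x ^+ 0 * phi x)%:E = 1)%E.
  by under eq_integral do rewrite mul1r; exact: integral_normal_pdf.
have m1 := integral_expr_normal_rec (isT : (0 <= 3)%N).
have m2 := integral_expr_normal_rec (isT : (1 <= 3)%N).
have m3 := integral_expr_normal_rec (isT : (2 <= 3)%N).
have m4 := integral_expr_normal_rec (isT : (3 <= 3)%N).
rewrite /= in m1 m2 m3 m4; rewrite m0 mul0r mul0e in m1.
rewrite m0 in m2; rewrite m1 in m3; rewrite m2 in m4.
case: k => [|[|[|[|[|//]]]]] _.
- by rewrite m0.
- by rewrite m1.
- by rewrite m2 -EFinM /normal_moment/=; congr EFin; field.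
- by rewrite m3 mule0.
- by rewrite m4 -!EFinM /normal_moment/=; congr EFin; field.
Qed.

End standard_moments.

(** * Means of complex random variables *)

Section expectation.
Context {R : realType}.

(** Bundling integrability with the value lets means be combined by linearity and products without
    separate integrability side conditions. *)
Definition has_mean d (T : measurableType d) (P : probability T R)
    (f : T -> R) (v : R) : Prop :=
  P.-integrable setT (EFin \o f) /\ (\int[P]_x (f x)%:E = v%:E)%E.

Definition has_cmean d (T : measurableType d) (P : probability T R)
    (f : T -> R[i]) (v : R[i]) : Prop :=
  has_mean P (@complex.Re R \o f) (complex.Re v) /\
  has_mean P (@complex.Im R \o f) (complex.Im v).

Section linearity.
Context d {T : measurableType d} (P : probability T R).

Lemma has_mean_cst (c : R) : has_mean P (cst c) c.
Proof.
split; first exact: finite_measure_integrable_cst.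
by have := integral_cst P measurableT c%:E;
  rewrite [X in (_ * X)%E]probability_setT mule1.
Qed.

Lemma has_meanD (f g : T -> R) (u v : R) :
  has_mean P f u -> has_mean P g v -> has_mean P (fun x => f x + g x) (u + v).
Proof.
move=> [fi fu] [gi gv]; split; first exact: (integrableD measurableT fi gi).
under eq_integral do rewrite EFinD.
by rewrite (integralD measurableT fi gi) fu gv.
Qed.

Lemma has_meanZ (c : R) (f : T -> R) (u : R) :
  has_mean P f u -> has_mean P (fun x => c * f x) (c * u).
Proof.
move=> [fi fu]; split; first exact: (integrableZl measurableT c fi).
under eq_integral do rewrite EFinM.
by rewrite (integralZl measurableT fi) fu.
Qed.

Lemma has_meanB (f g : T -> R) (u v : R) :
  has_mean P f u -> has_mean P g v -> has_mean P (fun x => f x - g x) (u - v).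
Proof.
move=> fu /(has_meanZ (-1)) gv; have := has_meanD fu gv.
rewrite mulN1r; under [X in has_mean _ X _]eq_fun do rewrite mulN1r.
by [].
Qed.

Lemma has_cmean_cst (c : R[i]) : has_cmean P (cst c) c.
Proof. by split; exact: has_mean_cst. Qed.

Lemma has_cmeanD (f g : T -> R[i]) (u v : R[i]) :
  has_cmean P f u -> has_cmean P g v ->
  has_cmean P (fun x => f x + g x) (u + v).
Proof.
move=> [fu fu'] [gv gv']; split.
  have := has_meanD fu gv; rewrite -raddfD.
  by congr (has_mean _ _ _); apply/funext => x /=; rewrite raddfD.
have := has_meanD fu' gv'; rewrite -raddfD.
by congr (has_mean _ _ _); apply/funext => x /=; rewrite raddfD.
Qed.

Lemma has_cmean_sum (I : Type) (r : seq I) (Q : pred I)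
    (f : I -> T -> R[i]) (v : I -> R[i]) :
  (forall i, Q i -> has_cmean P (f i) (v i)) ->
  has_cmean P (fun x => \sum_(i <- r | Q i) f i x) (\sum_(i <- r | Q i) v i).
Proof.
move=> fv; elim: r => [|i r IHr].
  rewrite big_nil; under [X in has_cmean _ X _]eq_fun do rewrite big_nil.
  exact: has_cmean_cst.
rewrite big_cons; under [X in has_cmean _ X _]eq_fun do rewrite big_cons.
by case: ifPn => // Qi; apply: has_cmeanD => //; exact: fv.
Qed.

Lemma has_cmeanZ (c : R[i]) (f : T -> R[i]) (u : R[i]) :
  has_cmean P f u -> has_cmean P (fun x => c * f x) (c * u).
Proof.
move=> [fu fu']; split.
  have := has_meanB (has_meanZ (complex.Re c) fu) (has_meanZ (complex.Im c) fu').
  congr (has_mean _ _ _); last by case: c u {fu fu'} => [a b] [].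
  by apply/funext => x /=; case: c (f x) => [a b] [].
have := has_meanD (has_meanZ (complex.Re c) fu') (has_meanZ (complex.Im c) fu).
congr (has_mean _ _ _); last by case: c u {fu fu'} => [a b] [].
by apply/funext => x /=; case: c (f x) => [a b] [].
Qed.

Lemma has_cmean_real (f : T -> R) (v : R) :
  has_mean P f v -> has_cmean P (fun x => (f x)%:C) v%:C.
Proof. by move=> fv; split => //; exact: has_mean_cst. Qed.

End linearity.

(** Fubini: the iterated integral of the absolute value factors into two finite integrals, which
    gives integrability; the signed iterated integral then factors in the same way. *)
Lemma has_mean_prod d1 d2 (T1 : measurableType d1) (T2 : measurableType d2)
    (P : probability T1 R) (Q : probability T2 R) (f : T1 -> R) (g : T2 -> R)
    (u v : R) :
  has_mean P f u -> has_mean Q g v ->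
  has_mean (P \x Q)%E (fun x => f x.1 * g x.2) (u * v).
Proof.
move=> [fi fu] [gi gv].
have mf : measurable_fun setT f by exact/measurable_EFinP/(measurable_int P fi).
have mg : measurable_fun setT g by exact/measurable_EFinP/(measurable_int Q gi).
have mfg : measurable_fun setT (fun x : T1 * T2 => (f x.1 * g x.2)%:E).
  apply/measurable_EFinP; apply: measurable_funM.
    exact: (measurableT_comp mf measurable_fst).
  exact: (measurableT_comp mg measurable_snd).
have ifg : (P \x Q)%E.-integrable setT (EFin \o (fun x : T1 * T2 => f x.1 * g x.2)).
  apply/integrable12ltyP => //=.
  have -> : (\int[P]_x \int[Q]_y `|(f x * g y)%:E| =
             \int[P]_x `|(f x)%:E| * \int[Q]_y `|(g y)%:E|)%E.
    have gfin : (\int[Q]_y `|(g y)%:E|)%E \is a fin_num.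
      exact: (integrable_fin_num measurableT (integrable_abse gi)).
    rewrite -(fineK gfin) -(integralZr measurableT (integrable_abse fi)).
    apply: eq_integral => x _; rewrite (fineK gfin).
    under eq_integral do rewrite EFinM abseM.
    by rewrite ge0_integralZl// ?abse_ge0//;
      apply: measurableT_comp => //; exact/measurable_EFinP.
  rewrite lte_mul_pinfty ?integral_ge0//.
    exact: (integrable_fin_num measurableT (integrable_abse fi)).
  by have /integrableP[] := gi.
split => //.
rewrite -integral12_prod_meas1//= /fubini_F /=.
transitivity (\int[P]_x ((f x)%:E * v%:E))%E.
  apply: eq_integral => x _.
  under eq_integral do rewrite EFinM.
  by rewrite (integralZl measurableT gi) gv.
by rewrite (integralZr measurableT fi) fu.
Qed.

Lemma has_cmean_prod d1 d2 (T1 : measurableType d1) (T2 : measurableType d2)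
    (P : probability T1 R) (Q : probability T2 R)
    (f : T1 -> R[i]) (g : T2 -> R[i]) (u v : R[i]) :
  has_cmean P f u -> has_cmean Q g v ->
  has_cmean (P \x Q)%E (fun x => f x.1 * g x.2) (u * v).
Proof.
move=> [fu fu'] [gv gv']; split.
  have := has_meanB (has_mean_prod fu gv) (has_mean_prod fu' gv').
  congr (has_mean _ _ _); last by case: u v {fu fu' gv gv'} => [? ?] [].
  by apply/funext => x /=; case: (f x.1) (g x.2) => [? ?] [].
have := has_meanD (has_mean_prod fu gv') (has_mean_prod fu' gv).
congr (has_mean _ _ _); last by case: u v {fu fu' gv gv'} => [? ?] [].
by apply/funext => x /=; case: (f x.1) (g x.2) => [? ?] [].
Qed.

(** * Measurability of complex arithmetic, through real and imaginary parts *)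

Section complex_measurability.

Lemma measurable_Re : measurable_fun setT (@complex.Re R).
Proof.
move=> _ B mB; rewrite setTI; apply: sub_sigma_algebra.
exists (B `*` setT); first exact: measurableX.
by rewrite setTI; apply/seteqP; split => [x []|x xB].
Qed.

Lemma measurable_Im : measurable_fun setT (@complex.Im R).
Proof.
move=> _ B mB; rewrite setTI; apply: sub_sigma_algebra.
exists (setT `*` B); first exact: measurableX.
by rewrite setTI; apply/seteqP; split => [x []|x xB].
Qed.

Lemma measurable_fun_complex d (T : measurableType d) (f : T -> R[i]) :
  measurable_fun setT (@complex.Re R \o f) ->
  measurable_fun setT (@complex.Im R \o f) -> measurable_fun setT f.
Proof.
move=> mRe mIm.
have -> : f = complex_of_pair \o (fun x => (complex.Re (f x), complex.Im (f x))).
  by apply/funext => x /=; case: (f x).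
apply: measurableT_comp; first exact: measurable_complex_of_pair.
exact/measurable_fun_pair.
Qed.

Lemma measurable_complexD d (T : measurableType d) (f g : T -> R[i]) :
  measurable_fun setT f -> measurable_fun setT g ->
  measurable_fun setT (fun x => f x + g x).
Proof.
move=> mf mg.
have mRf := measurableT_comp measurable_Re mf.
have mIf := measurableT_comp measurable_Im mf.
have mRg := measurableT_comp measurable_Re mg.
have mIg := measurableT_comp measurable_Im mg.
apply: measurable_fun_complex.
  have := measurable_funD mRf mRg.
  by congr measurable_fun; apply/funext => x /=; rewrite raddfD.
have := measurable_funD mIf mIg.
by congr measurable_fun; apply/funext => x /=; rewrite raddfD.
Qed.

Lemma measurable_complexM d (T : measurableType d) (f g : T -> R[i]) :
  measurable_fun setT f -> measurable_fun setT g ->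
  measurable_fun setT (fun x => f x * g x).
Proof.
move=> mf mg.
have mRf := measurableT_comp measurable_Re mf.
have mIf := measurableT_comp measurable_Im mf.
have mRg := measurableT_comp measurable_Re mg.
have mIg := measurableT_comp measurable_Im mg.
apply: measurable_fun_complex.
  have := measurable_funB (measurable_funM mRf mRg)
    (measurable_funM mIf mIg).
  by congr measurable_fun; apply/funext => x /=; case: (f x) (g x) => [? ?] [].
have := measurable_funD (measurable_funM mRf mIg)
  (measurable_funM mIf mRg).
by congr measurable_fun; apply/funext => x /=; case: (f x) (g x) => [? ?] [].
Qed.

Lemma measurable_complexX d (T : measurableType d) (f : T -> R[i]) (k : nat) :
  measurable_fun setT f -> measurable_fun setT (fun x => f x ^+ k).
Proof.
move=> mf; elim: k => [|k IHk].
  by under eq_fun do rewrite expr0; exact: measurable_cst.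
by under eq_fun do rewrite exprS; exact: measurable_complexM.
Qed.

Lemma measurable_conjc d (T : measurableType d) (f : T -> R[i]) :
  measurable_fun setT f -> measurable_fun setT (fun x => (f x)^*%C).
Proof.
move=> mf; apply: measurable_fun_complex.
  have := measurableT_comp measurable_Re mf.
  by congr measurable_fun; apply/funext => x /=; case: (f x).
have := measurable_funN (measurableT_comp measurable_Im mf).
by congr measurable_fun; apply/funext => x /=; case: (f x).
Qed.

Lemma measurable_complex_sum d (T : measurableType d) (I : Type) (r : seq I)
    (f : I -> T -> R[i]) :
  (forall i, measurable_fun setT (f i)) ->
  measurable_fun setT (fun x => \sum_(i <- r) f i x).
Proof.
move=> mf; elim: r => [|i r IHr].
  by under eq_fun do rewrite big_nil; exact: measurable_cst.
by under eq_fun do rewrite big_cons; exact: measurable_complexD.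
Qed.

Lemma measurable_complex_prod d (T : measurableType d) (I : Type) (r : seq I)
    (f : I -> T -> R[i]) :
  (forall i, measurable_fun setT (f i)) ->
  measurable_fun setT (fun x => \prod_(i <- r) f i x).
Proof.
move=> mf; elim: r => [|i r IHr].
  by under eq_fun do rewrite big_nil; exact: measurable_cst.
by under eq_fun do rewrite big_cons; exact: measurable_complexM.
Qed.

End complex_measurability.

(** * Means under image laws and under i.i.d. tuples and matrices *)

Lemma has_mean_distribution d1 d2 (T1 : measurableType d1)
    (T2 : measurableType d2) (P : probability T1 R) (X : {mfun T1 >-> T2})
    (f : T2 -> R) (v : R) :
  measurable_fun setT f -> has_mean P (f \o X) v ->
  has_mean (distribution P X) f v.
Proof.
move=> mf [fi fv]; have mEf : measurable_fun setT (EFin \o f) by exact/measurable_EFinP.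
split; first exact: integrable_pushforward.
by rewrite integral_distribution.
Qed.

Lemma has_cmean_distribution d1 d2 (T1 : measurableType d1)
    (T2 : measurableType d2) (P : probability T1 R) (X : {mfun T1 >-> T2})
    (f : T2 -> R[i]) (v : R[i]) :
  measurable_fun setT f -> has_cmean P (f \o X) v ->
  has_cmean (distribution P X) f v.
Proof.
move=> mf [fv fv']; split; apply: has_mean_distribution => //.
  exact: measurableT_comp measurable_Re mf.
exact: measurableT_comp measurable_Im mf.
Qed.

(** Independence in product form. The induction follows [iid_tuple]: peel off the first coordinate
    as one factor of a product measure. *)
Lemma has_cmean_iid_tuple d (T : measurableType d) (P : probability T R)
    (n : nat) (f : 'I_n -> T -> R[i]) (v : 'I_n -> R[i]) :
  (forall i, measurable_fun setT (f i)) ->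
  (forall i, has_cmean P (f i) (v i)) ->
  has_cmean (iid_tuple P n) (fun t => \prod_(i < n) f i (tnth t i))
    (\prod_(i < n) v i).
Proof.
elim: n f v => [|n IHn] f v mf fv.
  rewrite big_ord0; under [X in has_cmean _ X _]eq_fun do rewrite big_ord0.
  exact: has_cmean_cst.
apply: has_cmean_distribution.
  apply: measurable_complex_prod => i.
  exact: (measurableT_comp (mf i) (measurable_tnth i)).
have := has_cmean_prod (fv ord0) (IHn (f \o lift ord0) (v \o lift ord0)
  (fun i => mf _) (fun i => fv _)).
congr (has_cmean _ _ _); last by rewrite big_ord_recl.
apply/funext => -[x t] /=; rewrite big_ord_recl; congr (_ * _).
by apply: eq_bigr => i _; rewrite tnthS.
Qed.

Lemma measurable_matrix_entry d (T : measurableType d) (m n : nat) (i : 'I_m)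
    (j : 'I_n) : measurable_fun setT (fun X : 'M[T]_(m, n) => X i j).
Proof.
move=> _ B mB; apply: sub_sigma_algebra; exists (i, j) => //.
by exists B.
Qed.

Lemma has_cmean_iid_matrix d (T : measurableType d) (P : probability T R)
    (m n : nat) (f : 'I_m -> 'I_n -> T -> R[i]) (v : 'I_m -> 'I_n -> R[i]) :
  (forall i j, measurable_fun setT (f i j)) ->
  (forall i j, has_cmean P (f i j) (v i j)) ->
  has_cmean (iid_matrix P m n)
    (fun X => \prod_(i < m) \prod_(j < n) f i j (X i j))
    (\prod_(i < m) \prod_(j < n) v i j).
Proof.
move=> mf fv; apply: has_cmean_distribution.
  apply: measurable_complex_prod => i; apply: measurable_complex_prod => j.
  exact: (measurableT_comp (mf i j) (measurable_matrix_entry _ _)).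
have := @has_cmean_iid_tuple _ _ (iid_tuple P n) m
  (fun i t => \prod_(j < n) f i j (tnth t j)) (fun i => \prod_(j < n) v i j).
rewrite (_ : _ \o _ = fun t => \prod_(i < m) \prod_(j < n) f i j (tnth (tnth t i) j)).
  apply => [i|i]; last exact: has_cmean_iid_tuple.
  apply: measurable_complex_prod => j.
  exact: (measurableT_comp (mf i j) (measurable_tnth j)).
apply/funext => t /=; apply: eq_bigr => i _; apply: eq_bigr => j _.
by rewrite mxE.
Qed.

End expectation.

(** * Moments of the complex Gaussian distribution *)

Section complex_moments.
Context {R : realType}.
Local Notation N := (normal_prob 0 (Num.sqrt (2^-1 : R))).

Lemma has_mean_normal_expr (k : nat) : (k <= 4)%N ->
  has_mean N (fun x : R => x ^+ k) (normal_moment k).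
Proof.
move=> k4.
have mk : measurable_fun setT (fun x : R => x ^+ k) by exact: measurable_funX.
have ik := integrable_expr_normal (R := R) k4.
split; first exact: integrable_normal_prob.
by rewrite integral_normal_prob// integral_expr_normal.
Qed.

Definition gaussian_moment (p q : nat) : R[i] := if p == q then p`!%:R else 0.

(** Writing [z = x + iy] and expanding both powers binomially leaves products of real moments of the
    independent [x] and [y]. The bounds on [p] and [q] keep every real exponent at most 4. *)
Lemma has_cmean_complex_gaussian (p q : nat) : (p <= 2)%N -> (q <= 2)%N ->
  has_cmean (complex_gaussian R) (fun z => z ^+ p * z^*%C ^+ q)
    (gaussian_moment p q).
Proof.
move=> p2 q2; apply: has_cmean_distribution.
  apply: measurable_complexM; apply: measurable_complexX => //.
  exact: measurable_conjc.
(* Here [j] counts the factors [iy] taken from [z^p], and [k] the factors [-iy] taken from the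
   conjugate power. *)
pose coeff (j k : nat) : R[i] := 'C(p, j)%:R * 'C(q, k)%:R * 'i%C ^+ j * (- 'i%C) ^+ k.
have : has_cmean (N \x N)%E (fun w => \sum_(j < p.+1) \sum_(k < q.+1)
     coeff j k * ((w.1 ^+ (p - j + (q - k)))%:C * (w.2 ^+ (j + k))%:C))
   (\sum_(j < p.+1) \sum_(k < q.+1)
     coeff j k * ((normal_moment (p - j + (q - k)))%:C * (normal_moment (j + k))%:C)).
  apply: has_cmean_sum => j _; apply: has_cmean_sum => k _; apply: has_cmeanZ.
  have jp : (j <= p)%N by rewrite -ltnS.
  have kq : (k <= q)%N by rewrite -ltnS.
  have mx : (p - j + (q - k) <= 4)%N.
    exact: (leq_add (leq_trans (leq_subr _ _) p2) (leq_trans (leq_subr _ _) q2)).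
  have my : (j + k <= 4)%N by exact: (leq_add (leq_trans jp p2) (leq_trans kq q2)).
  exact: (has_cmean_prod (has_cmean_real (has_mean_normal_expr mx))
    (has_cmean_real (has_mean_normal_expr my))).
congr (has_cmean _ _ _).
  apply/funext => -[x y] /=.
  have -> : complex_of_pair (x, y) = x%:C + 'i%C * y%:C by exact: complexE.
  have -> : x -i* y = x%:C + (- 'i%C) * y%:C :> R[i] by simpc.
  rewrite 2!exprDn [RHS]big_distrl/=; apply: eq_bigr => j _.
  rewrite [RHS]big_distrr/=; apply: eq_bigr => k _.
  rewrite /coeff -(mulr_natr _ 'C(p, j)) -(mulr_natr _ 'C(q, k)).
  rewrite !exprMn !exprD !rmorphM !rmorphXn/=; ring.
have i2 : 'i%C ^+ 2 = -1 :> R[i] by exact: sqr_i.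
have c21 : 'C(2, bump 0 0) = 2%N by [].
have f2 : 2`! = 2%N by [].
(* Nine explicit cases remain, each a field identity modulo [i^2 = -1]. *)
case: p q p2 q2 @coeff => [|[|[|//]]] [|[|[|//]]] _ _ coeff;
  rewrite !big_ord_recl !big_ord0 /coeff /normal_moment /gaussian_moment/=
    ?fmorph_div ?fmorphV ?rmorph_nat ?rmorph0 ?rmorph1 ?c21 ?f2; field: i2 => //.
Qed.

End complex_moments.

(** * Set stabilizers in the symmetric group *)

Section set_stabilizers.
Local Open Scope group_scope.
Local Open Scope set_scope.

(** The indicator tuples of [A] and [B] contain equally many [true] and equally many [false], so one
    is a rearrangement of the other. The rearranging permutation maps [A] into [B], and onto it by
    cardinality. *)
Lemma exists_perm_imset (n : nat) (A B : {set 'I_n}) :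
  #|A| = #|B| -> exists s : 'S_n, s @: A = B.
Proof.
move=> cAB; pose ind (C : {set 'I_n}) := [tuple i \in C | i < n].
have cind C : count_mem true (ind C) = #|C|.
  by rewrite /= count_map -sum1_card -sum1_count big_enum_cond/=;
    apply: eq_bigl => i; rewrite /= eqb_id.
have /tuple_permP[s indE] : perm_eq (ind A) (ind B).
  apply/allP => -[] _ /=; rewrite -/(ind A) -/(ind B).
    by rewrite !cind cAB.
  have cF C : count_mem false (ind C) = (n - #|C|)%N.
    rewrite -cind -[X in (X - _)%N](size_tuple (ind C)).
    rewrite -(count_predC (pred1 true)) addKn.
    by apply: eq_count => -[].
  by rewrite !cF cAB.
exists s; apply/eqP; rewrite eqEcard card_imset ?cAB ?leqnn ?andbT; last exact: perm_inj.
apply/fintype.subsetP => _ /imsetP[i iA ->].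
have := congr1 (fun t : seq bool => nth false t i) indE.
have E (t : n.-tuple bool) : nth false t i = tnth t i by rewrite (tnth_nth false).
by rewrite !E /ind !tnth_mktuple iA => <-.
Qed.

(** Every orbit of subsets contains an initial segment of length [k], and [k] takes only the values
    0 to [n]. *)
Lemma card_orbit_setact_le (n : nat) :
  (#|orbit ('P^*) [set: 'S_n] @: [set: {set 'I_n}]| <= n.+1)%N.
Proof.
pose h (k : 'I_n.+1) := orbit ('P^*) [set: 'S_n] [set i : 'I_n | (i < k)%N].
have := leq_imset_card h [set: 'I_n.+1]; rewrite cardsT card_ord.
apply: leq_trans; apply: subset_leq_card; apply/fintype.subsetP => _ /imsetP[W _ ->].
have Wn : (#|W| < n.+1)%N by rewrite ltnS -[X in (_ <= X)%N]card_ord max_card.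
apply/imsetP; exists (Ordinal Wn) => //.
have [|s sW] := @exists_perm_imset n W [set i : 'I_n | (i < #|W|)%N].
  rewrite -sum1dep_card (big_ord_narrow (ltnSE Wn)).
  by rewrite sum1_card card_ord.
apply/esym/orbit_eqP/orbitP; exists s => //=.
by rewrite inE.
Qed.

(** For fixed [W] and [s], substituting [t = p * s] turns the condition into [p(W) = W], so the sum
    over [s] contributes a factor [n!]. Burnside's orbit counting for the action on subsets supplies
    the other [n!] and the number of orbits. *)
Lemma sum_perm_imset_eq (n : nat) :
  (\sum_(W : {set 'I_n}) \sum_(s : 'S_n) \sum_(t : 'S_n) (s @: W == t @: W) <=
    n.+1 * n`! ^ 2)%N.
Proof.
have -> : (\sum_(W : {set 'I_n}) \sum_(s : 'S_n) \sum_(t : 'S_n) (s @: W == t @: W)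
  = \sum_(W : {set 'I_n}) n`! * \sum_(p : 'S_n) (p @: W == W))%N.
  apply: eq_bigr => W _.
  rewrite -card_Sn -sum1_card big_distrl/=; apply: eq_bigr => s _.
  rewrite mul1n (reindex_inj (mulIg s)); apply: eq_bigr => p _.
  have -> : (p * s) @: W = s @: (p @: W).
    by rewrite -imset_comp; apply: eq_imset => x; rewrite permM.
  by rewrite (inj_eq (imset_inj (@perm_inj _ s))) eq_sym.
rewrite -big_distrr/= expnS expn1 mulnCA leq_mul2l; apply/orP; right.
rewrite exchange_big/=.
have acts : [acts [set: 'S_n], on [set: {set 'I_n}] | 'P^*].
  by apply/actsP => s _ W; rewrite !inE.
have -> : (\sum_(p : 'S_n) \sum_(W : {set 'I_n}) (p @: W == W))%N =
    (\sum_(p in [set: 'S_n]) #|'Fix_([set: {set 'I_n}] | 'P^*)[p]|)%N.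
  apply: eq_big => [p|p _]; first by rewrite inE.
  rewrite -sum1_card [RHS]big_mkcond; apply: eq_bigr => W _ /=.
  have -> : (W \in 'Fix_([set: {set 'I_n}] | 'P^*)[p]) = (p @: W == W).
    by rewrite inE finset.in_setT /=; apply/afix1P/eqP.
  by case: eqP.
rewrite (Frobenius_Cauchy acts) cardsT card_Sn leq_mul2r.
by rewrite card_orbit_setact_le orbT.
Qed.

(** The pair is forced: [a] is [s] on [W] and [t] off [W], and [b] is the reverse, so there is at
    most one. If it exists, [a(W) = s(W)], while [a] and [t] agree off [W]; taking complements,
    [a(W) = t(W)]. *)
Lemma card_splice_le (n : nat) (W : {set 'I_n}) (s t : 'S_n) :
  (\sum_(a : 'S_n) \sum_(b : 'S_n)
    [forall i, if i \in W then (s i == a i) && (t i == b i)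
               else (s i == b i) && (t i == a i)] <= (s @: W == t @: W))%N.
Proof.
rewrite pair_big/=.
set Q := fun p : 'S_n * 'S_n => [forall i, if i \in W
  then (s i == p.1 i) && (t i == p.2 i) else (s i == p.2 i) && (t i == p.1 i)].
have -> : (\sum_(p : 'S_n * 'S_n) [forall i, if i \in W
  then (s i == p.1 i) && (t i == p.2 i) else (s i == p.2 i) && (t i == p.1 i)])%N
  = #|[set p | Q p]|.
  by rewrite -sum1dep_card [RHS]big_mkcond/=; apply: eq_bigr => p _;
    rewrite /Q; case: ifP.
have Q1 : (#|[set p | Q p]| <= 1)%N.
  apply/card_le1P => -[a b]; rewrite inE => /forallP/= Qab [a' b']; rewrite !inE.
  apply/idP/eqP => [/forallP/= Qab'|[-> ->]]; last exact/forallP.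
  congr (_, _); apply/permP => i; have := Qab i; have := Qab' i;
    by case: ifP => _ /andP[/eqP e1 /eqP e2] /andP[/eqP e3 /eqP e4]; congruence.
have [->|[[a b]]] := set_0Vmem [set p | Q p]; first by rewrite cards0.
rewrite inE => /forallP/= Qab.
suff -> : s @: W = t @: W by rewrite eqxx.
have -> : s @: W = a @: W.
  by apply: eq_in_imset => i iW; have := Qab i; rewrite iW => /andP[/eqP].
apply: finset.setC_inj.
have imsetC (p : 'S_n) : ~: (p @: W) = p @: (~: W).
  apply/setP => y; rewrite inE -(permKV p y) !mem_imset ?inE//; exact: perm_inj.
rewrite !imsetC; apply: eq_in_imset => i; rewrite inE => iW.
by have := Qab i; rewrite (negbTE iW) => /andP[_ /eqP].
Qed.

End set_stabilizers.

(** * The Paley-Zygmund inequality *)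

Section paley_zygmund.
Context d {T : measurableType d} {R : realType} (P : probability T R).

Lemma has_mean_indic (A : set T) : measurable A ->
  has_mean P (\1_A : T -> R) (fine (P A)).
Proof.
move=> mA; split; first exact: integrable_indic.
by rewrite integral_indic// setIT fineK// fin_num_measure.
Qed.

Lemma has_mean_ge0 (f : T -> R) (v : R) :
  (forall x, 0 <= f x) -> has_mean P f v -> 0 <= v.
Proof.
move=> f0 [_ fv]; rewrite -lee_fin -fv.
by apply: integral_ge0 => x _; rewrite lee_fin.
Qed.

(** Instead of Cauchy-Schwarz, one takes the mean of a pointwise nonnegative function quadratic in
    [Z]. Only an upper bound [M] on the second moment enters. The case [alpha = 0] is separate: the
    event is then everything and strictness comes from [m^2 < M]. *)
Lemma paley_zygmund_lt (Z : T -> R) (m v M alpha : R) :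
  measurable_fun setT Z -> (forall x, 0 <= Z x) ->
  has_mean P Z m -> has_mean P (fun x => Z x ^+ 2) v -> v <= M ->
  0 < m -> m ^+ 2 < M -> 0 <= alpha -> alpha < 1 ->
  (((1 - alpha) ^+ 2 * m ^+ 2 / M)%:E < P [set x | (alpha * m <= Z x)%R])%E.
Proof.
move=> mZ Z0 Zm Zv vM m0 mM a0 a1; set A := [set x | _].
have M0 : 0 < M by rewrite (le_lt_trans _ mM)// sqr_ge0.
have [a00|a_neq0] := eqVneq alpha 0.
  have -> : A = setT by apply/seteqP; split => // x _; rewrite /A/= a00 mul0r.
  rewrite probability_setT lte_fin a00 subr0 expr1n mul1r.
  by rewrite ltr_pdivrMr// mul1r.
have ap : 0 < alpha by rewrite lt_neqAle eq_sym a_neq0.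
have mA : measurable A.
  have -> : A = Z @^-1` `[alpha * m, +oo[.
    by apply/seteqP; split => x; rewrite /A/= in_itv/= andbT.
  by rewrite -[X in measurable X]setTI; exact: mZ.
have /fineK <- : P A \is a fin_num by exact: fin_num_measure.
rewrite lte_fin; set p := fine (P A).
(* This [t] minimises [t^2 M - 2 t (1 - alpha) m], making the bound below optimal. *)
pose t := (1 - alpha) * m / M.
have t0 : 0 < t by rewrite divr_gt0// mulr_gt0// subr_gt0.
have hp : has_mean P (\1_A : T -> R) p by exact: has_mean_indic.
(* The integrand is (1 - t Z)^2 on A and 2 t (alpha m - Z) + (t Z)^2 off A. *)
have hmean := has_meanD (has_meanB (has_meanZ (1 - 2 * t * (alpha * m)) hp)
  (has_meanZ (2 * t) Zm)) (has_meanD (has_meanZ (t ^+ 2) Zv)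
  (has_mean_cst P (2 * t * (alpha * m)))).
have tM : t * M = (1 - alpha) * m by rewrite /t divfK// gt_eqF.
have -> : (1 - alpha) ^+ 2 * m ^+ 2 / M = t * ((1 - alpha) * m).
  by rewrite /t; field; rewrite gt_eqF.
have : 0 <= (1 - 2 * t * (alpha * m)) * p - 2 * t * m +
    (t ^+ 2 * v + 2 * t * (alpha * m)).
  apply: has_mean_ge0 hmean => x; rewrite indicE.
  have [_|] := boolP (x \in A).
    by have := sqr_ge0 (1 - t * Z x); rewrite /cst/=; lra.
  rewrite notin_setE /A/= => /negP; rewrite -ltNge => zlt.
  have h1 : 0 < t * (alpha * m - Z x) by rewrite mulr_gt0// subr_gt0.
  have h2 : 0 <= t ^+ 2 * Z x ^+ 2 by rewrite mulr_ge0// sqr_ge0.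
  by rewrite /cst/=; lra.
have tv : t ^+ 2 * v <= t * ((1 - alpha) * m).
  by rewrite -tM mulrA -expr2 ler_wpM2l// exprn_ge0// ltW.
have tam : 0 < t * (alpha * m) by apply: mulr_gt0 => //; exact: mulr_gt0.
have tbm : 0 < t * ((1 - alpha) * m).
  by apply: mulr_gt0 => //; apply: mulr_gt0; rewrite // subr_gt0.
have p0 : 0 <= p by apply: fine_ge0; exact: measure_ge0.
have tamp : 0 <= t * (alpha * m) * p by rewrite mulr_ge0// ltW.
(* The mean inequality reads [p >= t (1 - alpha) m + 2 t alpha m p]. Hence [p > 0], so the last term
   is positive and makes the bound strict. *)
move=> ge0; have pgt0 : 0 < p by lra.
have : 0 < t * (alpha * m) * p by rewrite mulr_gt0.
by lra.
Qed.

End paley_zygmund.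

(** * Moments of the permanent *)

Section gaussian_matrix_moments.
Context {R : realType}.
Local Notation gm := (@gaussian_moment R).

(** The exponents encode one row's monomial [x_a conj(x_c)]; if [a] and [c] differ, column [a]
    contributes a factor with zero mean. *)
Lemma prod_gaussian_moment2 (n : nat) (a c : 'I_n) :
  \prod_(j < n) gm (a == j) (c == j) = (a == c)%:R.
Proof.
have [<-|ac] := eqVneq a c.
  by apply: big1 => j _; rewrite /gaussian_moment eqxx; case: (a == j).
by rewrite (bigD1 a)//= eqxx eq_sym (negbTE ac) /gaussian_moment/= mul0r.
Qed.

(** Wick's formula for a single row. A column with unequal exponents kills the product. When all
    four indices coincide, the moment [2! = 2] matches the two pairings counted on the right. *)
Lemma prod_gaussian_moment4 (n : nat) (a b c e : 'I_n) :
  \prod_(j < n) gm ((a == j) + (b == j)) ((c == j) + (e == j)) =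
  (((a == c) && (b == e)) + ((a == e) && (b == c)))%:R.
Proof.
have diag (x y : 'I_n) : \prod_(j < n) gm ((x == j) + (y == j)) ((x == j) + (y == j)) =
    (x == y).+1%:R.
  rewrite (bigD1 x)//= eqxx big1 ?mulr1 => [|j jx].
    by rewrite /gaussian_moment eqxx eq_sym; case: (x == y).
  by rewrite /gaussian_moment eqxx eq_sym (negbTE jx); case: (y == j).
have zero (j : 'I_n) : ((a == j) + (b == j) != (c == j) + (e == j))%N ->
    \prod_(j < n) gm ((a == j) + (b == j)) ((c == j) + (e == j)) = 0.
  by move=> neq; rewrite (bigD1 j)//= /gaussian_moment (negbTE neq) mul0r.
have [ac|ac] := eqVneq a c.
  have [be|be] := eqVneq b e; first by rewrite -ac -be diag (eq_sym b a); case: (a == b).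
  rewrite (zero b); last first.
    by rewrite ac eqn_add2l eqxx (eq_sym e) (negbTE be).
  by rewrite -ac (eq_sym b); have [->|//] := eqVneq a e; rewrite (eq_sym e) (negbTE be).
have [ae|ae] := eqVneq a e.
  have [bc|bc] := eqVneq b c.
    rewrite -ae -bc; under eq_bigr do rewrite [X in gm _ X]addnC.
    by rewrite diag bc (negbTE ac).
  by rewrite (zero b) ?andbF//= ae addnC eqn_add2r eqxx (eq_sym c) (negbTE bc).
by rewrite (zero a)// eqxx (eq_sym c) (eq_sym e) (negbTE ac) (negbTE ae).
Qed.

Lemma has_cmean_gaussian_matrix (n : nat) (p q : 'I_n -> 'I_n -> nat) :
  (forall i j, (p i j <= 2)%N) -> (forall i j, (q i j <= 2)%N) ->
  has_cmean (gaussian_matrix R n)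
    (fun X => \prod_(i < n) \prod_(j < n) (X i j ^+ p i j * (X i j)^*%C ^+ q i j))
    (\prod_(i < n) \prod_(j < n) gm (p i j) (q i j)).
Proof.
move=> p2 q2.
have mf i j : measurable_fun setT (fun z : R[i] => z ^+ p i j * z^*%C ^+ q i j).
  apply: measurable_complexM; apply: measurable_complexX => //.
  exact: measurable_conjc.
exact: (has_cmean_iid_matrix mf
  (fun i j => has_cmean_complex_gaussian (p2 i j) (q2 i j))).
Qed.

Lemma prod_expr_eq (n : nat) (F : 'I_n -> R[i]) (k : 'I_n) :
  \prod_(j < n) F j ^+ (k == j) = F k.
Proof.
rewrite (bigD1 k)//= eqxx expr1 big1 ?mulr1// => j jk.
by rewrite eq_sym (negbTE jk).
Qed.

(** Distinct permutation monomials are orthogonal: they differ in some row, whose factor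
    vanishes. *)
Lemma has_cmean_diagonal_product2 (n : nat) (s a : 'S_n) :
  has_cmean (gaussian_matrix R n)
    (fun X => (\prod_(i < n) X i (s i)) * (\prod_(i < n) X i (a i))^*%C)
    (s == a)%:R.
Proof.
have := @has_cmean_gaussian_matrix n (fun i j => s i == j) (fun i j => a i == j)
  (fun i j => leq_trans (leq_b1 _) (isT : (1 <= 2)%N))
  (fun i j => leq_trans (leq_b1 _) (isT : (1 <= 2)%N)).
congr (has_cmean _ _ _).
  apply/funext => X; rewrite rmorph_prod -big_split/=; apply: eq_bigr => i _.
  by rewrite big_split/= 2!prod_expr_eq.
rewrite (eq_bigr (fun i => (s i == a i)%:R)); last first.
  by move=> i _; exact: prod_gaussian_moment2.
have [->|sa] := eqVneq s a; first by rewrite big1// => i _; rewrite eqxx.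
have [i sai] : exists i, s i != a i.
  apply/existsP; apply: contraNT sa => /existsPn sa.
  by apply/eqP/permP => i; apply/eqP/negPn/sa.
by rewrite (bigD1 i)//= (negbTE sai) mul0r.
Qed.

Lemma has_cmean_diagonal_product4 (n : nat) (s t a b : 'S_n) :
  has_cmean (gaussian_matrix R n)
    (fun X => (\prod_(i < n) X i (s i)) * (\prod_(i < n) X i (t i)) *
      ((\prod_(i < n) X i (a i))^*%C * (\prod_(i < n) X i (b i))^*%C))
    (\prod_(i < n) (((s i == a i) && (t i == b i)) +
                   ((s i == b i) && (t i == a i))))%N%:R.
Proof.
have le2 (b1 b2 : bool) : (b1 + b2 <= 2)%N by case: b1 b2 => [] [].
have := @has_cmean_gaussian_matrix n (fun i j => (s i == j) + (t i == j))%N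
  (fun i j => (a i == j) + (b i == j))%N (fun i j => le2 _ _) (fun i j => le2 _ _).
congr (has_cmean _ _ _).
  apply/funext => X; rewrite !rmorph_prod -!big_split/=; apply: eq_bigr => i _.
  under eq_bigr do rewrite 2!exprD.
  by rewrite !big_split/= !prod_expr_eq.
rewrite natr_prod; apply: eq_bigr => i _; exact: prod_gaussian_moment4.
Qed.

(** Expanding the product over rows of two-term sums gives a sum over the set [W] of rows where the
    first pairing is used. Each [W] is then bounded by [card_splice_le], and the total by
    [sum_perm_imset_eq]. *)
Lemma sum_wick_le (n : nat) :
  (\sum_(s : 'S_n) \sum_(t : 'S_n) \sum_(a : 'S_n) \sum_(b : 'S_n)
    \prod_(i < n) (((s i == a i) && (t i == b i)) +
                   ((s i == b i) && (t i == a i))) <= n.+1 * n`! ^ 2)%N.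
Proof.
have prod_bool (c : 'I_n -> bool) : (\prod_(i < n) c i = [forall i, c i])%N.
  case: (boolP [forall i, c i]) => [/forallP cT|/forallPn[i ci]].
    by rewrite big1// => i _; rewrite cT.
  by rewrite (bigD1 i)//= (negbTE ci) mul0n.
apply: leq_trans (sum_perm_imset_eq n).
rewrite [leqRHS](exchange_big _ _ _ _ _ _)/=; apply: leq_sum => s _.
rewrite [leqRHS](exchange_big _ _ _ _ _ _)/=; apply: leq_sum => t _.
have -> : (\sum_(a : 'S_n) \sum_(b : 'S_n)
    \prod_(i < n) (((s i == a i) && (t i == b i)) +
                   ((s i == b i) && (t i == a i))) =
  \sum_(W : {set 'I_n}) \sum_(a : 'S_n) \sum_(b : 'S_n) \prod_(i < n)
    if i \in W then (s i == a i) && (t i == b i) : nat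
    else (s i == b i) && (t i == a i))%N.
  rewrite [RHS]exchange_big/=; apply: eq_bigr => a _.
  rewrite [RHS]exchange_big/=; apply: eq_bigr => b _.
  exact: bigA_distr.
apply: leq_sum => W _.
apply: leq_trans (card_splice_le W s t).
apply: leq_sum => a _; apply: leq_sum => b _.
rewrite -prod_bool; apply/eq_leq/eq_bigr => i _.
by case: (i \in W).
Qed.

Lemma has_cmean_permanent2 (n : nat) :
  has_cmean (gaussian_matrix R n)
    (fun X => permanent X * (permanent X)^*%C) n`!%:R.
Proof.
pose E := @has_cmean_sum R _ _ (gaussian_matrix R n) 'S_n (index_enum _) xpredT.
have := E _ _ (fun s _ => E _ _ (fun a _ => has_cmean_diagonal_product2 s a)).
congr (has_cmean _ _ _).
  apply/funext => X; rewrite /permanent rmorph_sum big_distrl/=.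
  by apply: eq_bigr => s _; rewrite big_distrr.
under eq_bigr => s _.
  rewrite (bigD1 s)//= eqxx big1 ?addr0 => [|a sa]; last first.
    by rewrite eq_sym (negbTE sa).
  over.
by rewrite sumr_const card_Sn.
Qed.

(** The value is left as the Wick sum, since Paley-Zygmund needs only its upper bound. *)
Lemma has_cmean_permanent4 (n : nat) : exists2 v : nat,
  has_cmean (gaussian_matrix R n)
    (fun X => (permanent X * (permanent X)^*%C) ^+ 2) v%:R &
  (v <= n.+1 * n`! ^ 2)%N.
Proof.
exists (\sum_(s : 'S_n) \sum_(t : 'S_n) \sum_(a : 'S_n) \sum_(b : 'S_n)
    \prod_(i < n) (((s i == a i) && (t i == b i)) +
                   ((s i == b i) && (t i == a i))))%N; last exact: sum_wick_le.
pose E := @has_cmean_sum R _ _ (gaussian_matrix R n) 'S_n (index_enum _) xpredT.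
have := E _ _ (fun s _ => E _ _ (fun t _ => E _ _ (fun a _ => E _ _ (fun b _ =>
  has_cmean_diagonal_product4 s t a b)))).
congr (has_cmean _ _ _).
  apply/funext => X; rewrite /permanent rmorph_sum exprMn !expr2/=.
  rewrite -mulrA big_distrl/=; apply: eq_bigr => s _.
  rewrite mulrA big_distrr/= big_distrl/=; apply: eq_bigr => t _.
  rewrite big_distrl/= big_distrr/=; apply: eq_bigr => a _.
  by rewrite !big_distrr.
by rewrite !natr_sum; do 3 (apply: eq_bigr => ? _; rewrite natr_sum).
Qed.

End gaussian_matrix_moments.

(** * Anticoncentration of the permanent *)

Lemma measurable_permanent (R : realType) (n : nat) :
  measurable_fun setT (fun X : 'M[R[i]]_n => permanent X).
Proof.
apply: measurable_complex_sum => s; apply: measurable_complex_prod => i.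
exact: measurable_matrix_entry.
Qed.

Unset Implicit Arguments.

Theorem theorem54 (R : realType) (alpha : R) (n : nat)
    (alpha_ge0 : 0 <= alpha) (alpha_lt1 : alpha < 1) (n_gt0 : (0 < n)%N) :
  (((1 - alpha) ^+ 2 / n.+1%:R)%:E <
   gaussian_matrix R n
     [set X : 'M[R[i]]_n |
       ((alpha * n`!%:R)%:C <= `|permanent X| ^+ 2)%R])%E.
Proof.
pose Z (X : 'M[R[i]]_n) : R :=
  complex.Re (permanent X) ^+ 2 + complex.Im (permanent X) ^+ 2.
have ZE X : (Z X)%:C = `|permanent X| ^+ 2 by exact: add_Re2_Im2.
have mper := @measurable_permanent R n.
have mZ : measurable_fun setT Z.
  apply: measurable_funD; apply: measurable_funX.
    exact: measurableT_comp measurable_Re mper.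
  exact: measurableT_comp measurable_Im mper.
have Z0 X : 0 <= Z X by rewrite addr_ge0// sqr_ge0.
have Z1 : has_mean (gaussian_matrix R n) Z n`!%:R.
  (* The variable is real, so the real component of the complex mean carries all the information. *)
  have [+ _] := @has_cmean_permanent2 R n.
  congr (has_mean _ _ _); last by rewrite -(rmorph_nat (real_complex R)).
  by apply/funext => X /=; rewrite -sqr_normc -ZE.
have [v [Z2 _] vM] := @has_cmean_permanent4 R n.
have {}Z2 : has_mean (gaussian_matrix R n) (fun X => Z X ^+ 2) v%:R.
  move: Z2; congr (has_mean _ _ _); last by rewrite -(rmorph_nat (real_complex R)).
  by apply/funext => X /=; rewrite -sqr_normc -ZE -rmorphXn.
have fact0 : 0 < n`!%:R :> R by rewrite ltr0n fact_gt0.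
have -> : [set X : 'M[R[i]]_n | ((alpha * n`!%:R)%:C <= `|permanent X| ^+ 2)%R] =
    [set X | (alpha * n`!%:R <= Z X)%R].
  by apply/seteqP; split => X /=; rewrite -ZE lecR.
(* Scaling by [n!^2] exhibits the bound with [m = n!] and [M = (n+1) n!^2]. *)
have -> : (1 - alpha) ^+ 2 / n.+1%:R =
    (1 - alpha) ^+ 2 * n`!%:R ^+ 2 / (n.+1%:R * n`!%:R ^+ 2).
  by rewrite -mulf_div divff ?mulr1// expf_neq0// gt_eqF.
apply: (paley_zygmund_lt mZ Z0 Z1 Z2) => //.
  by rewrite -natrX -natrM ler_nat.
(* The condition [m^2 < M] amounts to [1 < n + 1], that is, to [n] being positive. *)
by rewrite ltr_pMl ?exprn_gt0// ltr1n.
Qed.
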